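(* Let $n\ge d\ge 1$ be integers. Let $p(x,t)=\prod_{i=1}^d(x-r_i(t)^2)$ be a polynomial in $x$ of degree $d$ with nonnegative real roots that satisfies the partial differential equation $$\partial_t p(x,t)=-2\left(x\,\partial_x^2+(n+1)\,\partial_x\right)p(x,t).$$ Then the Cauchy transform of the empirical root distribution $$G(x,t)=\frac1d\sum_{i=1}^d\frac{1}{x-r_i(t)^2}$$ satisfies the partial differential equation $$\partial_t G+2\,\partial_x\left(d\,x\,G^2+(n+1)\,G+x\,\partial_x G\right)=0.$$
   Context: The time variable $t$ ranges over an interval on which the coefficients of $p(\cdot,t)$ are differentiable in $t$ and the PDE for $p$ holds; the PDE for $G$ is understood at all such $t$ and all $x\in\mathbb{C}\setminus\{r_1(t)^2,\dots,r_d(t)^2\}$. *)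

(* Defs.v *)
From HB Require Import structures.
From mathcomp Require Import all_boot all_order all_algebra.
From mathcomp Require Import interval complex.
From mathcomp Require Import boolp classical_sets set_interval reals topology.
From mathcomp Require Import normedtype derive.

Set Implicit Arguments.
Unset Strict Implicit.
Unset Printing Implicit Defensive.

Import Order.TTheory GRing.Theory Num.Theory.
Import numFieldNormedType.Exports.

Local Open Scope ring_scope.
Local Open Scope complex_scope.
Local Open Scope classical_set_scope.

(* The complex numbers as a normed space over themselves: on functions
   [R[i] -> R[i]], the library's [derivable] and [derive1] are then complex
   differentiability and the complex derivative. *)
HB.instance Definition _ (R : realType) := NormedModule.copy R[i] R[i]^o.

(* Differentiation of a complex-valued function of a real variable ranging over
   an interval [I]: the limit is taken along [s] in [I] only, hence it is the
   ordinary derivative at interior points and the one-sided derivative at an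
   endpoint belonging to [I]. As for [derive1], [tderive] is meaningful only
   when [tderivable] holds. *)
Definition tquotient (R : realType) (f : R -> R[i]) (t s : R) : R[i] :=
  ((s - t)^-1)%:C * (f s - f t).

Definition tderivable (R : realType) (I : interval R) (f : R -> R[i])
    (t : R) : Prop :=
  cvg (tquotient f t @ within [set` I] t^').

Definition tderive (R : realType) (I : interval R) (f : R -> R[i])
    (t : R) : R[i] :=
  lim (tquotient f t @ within [set` I] t^').

Definition sq_root_poly (R : realType) (d : nat) (r : 'I_d -> R -> R)
    (t : R) : {poly R[i]} :=
  \prod_(i < d) ('X - ((r i t ^+ 2)%:C)%:P).

Definition peval (R : realType) (p : R -> {poly R[i]}) (x : R[i])
    (t : R) : R[i] :=
  (p t).[x].

Definition cauchy_transform (R : realType) (d : nat) (r : 'I_d -> R -> R)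
    (x : R[i]) (t : R) : R[i] :=
  d%:R^-1 * \sum_(i < d) (x - (r i t ^+ 2)%:C)^-1.

(* Main.v *)
Require Import Defs.
From HB Require Import structures.
From mathcomp Require Import all_boot all_order all_algebra.
From mathcomp Require Import interval complex.
From mathcomp Require Import boolp classical_sets functions set_interval reals topology.
From mathcomp Require Import normedtype derive.
From mathcomp Require Import ring lra.

Set Implicit Arguments.
Unset Strict Implicit.
Unset Printing Implicit Defensive.

Import Order.TTheory GRing.Theory Num.Theory.
Import numFieldNormedType.Exports.

Local Open Scope ring_scope.
Local Open Scope complex_scope.
Local Open Scope classical_set_scope.

(** Write [P] for the polynomial in the space variable at a given time, and ['] for
    the derivative in space. The Cauchy transform is the logarithmic derivative
    [G = P' / (d P)] wherever [P] does not vanish ([cauchy_transformE]). Hence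
    [y G' = y P'' / (d P) - y (P'/P)^2 / d], whose quadratic part cancels
    [d y G^2], and the flux is
      [F = d y G^2 + (n + 1) G + y G' = (y P'' + (n + 1) P') / (d P)].
    If [Q] denotes the time derivative of [P], the equation satisfied by [P] says
    that [y P'' + (n + 1) P' = - Q / 2], so [F = - Q / (2 d P)]. Therefore
      [2 F' = - (Q' P - Q P') / (d P^2)],
    while the quotient rule in time, together with the fact that the time
    derivative of [P'] is [Q'], gives
      [dG/dt = (Q' P - P' Q) / (d P^2)],
    and the two add up to zero.

    In space, all derivatives are those of quotients of polynomials
    ([is_derive_horner_frac]). In time, the coefficients are differentiated along
    the interval, so [Q] is the polynomial whose coefficients are the derivatives
    of those of [P]; evaluation at a point and formal derivation are linear in the
    coefficients, which gives the time derivatives of [P] and of [P']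
    ([is_tderive_horner], [is_tderive_horner_deriv]). Since a root may move in
    time, the formula for [G] is only used near the time considered, where [P]
    remains nonzero at the chosen point by continuity ([is_tderive_continuous]). *)

(** * Complex differentiation of polynomials and their quotients *)

Section PolynomialDerivatives.
Variable K : numFieldType.
Lemma is_derive_horner (p : {poly K}) (x : K) :
  is_derive x 1 (horner p) p^`().[x].
Proof.
elim/poly_ind: p => [|p c ih].
  have -> : horner (0 : {poly K}) = cst 0 by apply/funext => y; rewrite horner0.
  by rewrite deriv0 horner0; exact: is_derive_cst.
have -> : horner (p * 'X + c%:P) = horner p * id + cst c.
  by apply/funext => y; rewrite !hornerE.
have dM := is_deriveD (is_deriveM ih (is_derive_id x 1)) (is_derive_cst c x 1).
apply: (is_derive_eq dM).
by rewrite derivMXaddC !hornerE /GRing.scale /=; ring.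
Qed.

Lemma near_horner_neq0 (p : {poly K}) (x : K) : p.[x] != 0 ->
  \forall y \near x, p.[y] != 0.
Proof.
move=> px.
have /derivable1_diffP/differentiable_continuous pc :=
  @ex_derive _ _ _ _ _ _ _ (is_derive_horner p x).
exact: cvgr_neq0 pc px.
Qed.

Lemma is_derive_horner_frac (p q : {poly K}) (x : K) : q.[x] != 0 ->
  is_derive x 1 (fun y => p.[y] / q.[y])
    ((p^`().[x] * q.[x] - p.[x] * q^`().[x]) / q.[x] ^+ 2).
Proof.
move=> qx.
have dV : is_derive x 1 (fun y => q.[y]^-1) (- q.[x] ^- 2 *: q^`().[x]).
  have [dq qE] := is_derive_horner q x.
  by apply: DeriveDef; [exact: derivableV | rewrite deriveV // qE].
apply: (is_derive_eq (is_deriveM (is_derive_horner p x) dV)).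
by rewrite /GRing.scale /=; field.
Qed.

Lemma derive1_horner (p : {poly K}) : (horner p)^`()%classic = horner (deriv p).
Proof.
by apply/funext => x; rewrite derive1E; case: (is_derive_horner p x).
Qed.

Lemma prod_XsubC_neq0 (d : nat) (c : 'I_d -> K) (y : K) :
  reflect (forall i, y != c i) ((\prod_(i < d) ('X - (c i)%:P)).[y] != 0).
Proof.
rewrite horner_prod; apply: (iffP (prodf_neq0 _ _)) => yc i => [|_].
  by have := yc i isT; rewrite hornerXsubC subr_eq0.
by rewrite hornerXsubC subr_eq0.
Qed.

(** Induction on the factors, with [deriv (('X - a) * Q) / (('X - a) * Q)] equal
    to [1 / ('X - a) + deriv Q / Q]; the non-vanishing of the partial products
    has to be carried along. *)
Lemma logderiv_prod_XsubC (d : nat) (c : 'I_d -> K) (y : K) :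
  let P := \prod_(i < d) ('X - (c i)%:P) in
  P.[y] != 0 -> P^`().[y] / P.[y] = \sum_(i < d) (y - c i)^-1.
Proof.
move=> P /prod_XsubC_neq0 yc.
pose ok (Q : {poly K}) S := Q.[y] != 0 /\ Q^`().[y] / Q.[y] = S.
suff [] : ok P (\sum_(i < d) (y - c i)^-1) by [].
apply: (big_rec2 ok) => [|i Q S _ [Q0 <-]].
  by rewrite /ok derivC !hornerE oner_eq0; split.
have ci : y - c i != 0 by rewrite subr_eq0.
rewrite /ok derivM derivXsubC !hornerE mulf_neq0 //; split=> //.
by field; apply/andP.
Qed.
End PolynomialDerivatives.

(** * Differentiation along an interval *)

Section IntervalDerivatives.
Variable R : realType.

(** Carrying the value of the derivative along with its existence lets the rules
    of calculus be chained without manipulating limits; properness of the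
    filter then matters only for reading off [tderive]. *)
Definition is_tderive (I : interval R) (f : R -> R[i]) (t : R)
    (l : R[i]) : Prop :=
  tquotient f t @ within [set` I] t^' --> l.

(** The segment from [t] to another point [u] of the interval stays in the
    interval and contains points arbitrarily close to [t], whether [t] is
    interior or an endpoint. *)
Lemma within_dnbhs_proper (I : interval R) (t : R) :
  (exists a b, [/\ a \in I, b \in I & a < b]) -> t \in I ->
  ProperFilter (within [set` I] t^').
Proof.
move=> [a [b [aI bI ab]]] tI.
have [u uI ut] : exists2 u, u \in I & u != t.
  by have [<-|] := eqVneq a t; [exists b; rewrite // gt_eqF | exists a].
split; last exact: within_filter.
case=> e /= e0 eI.
have w0 : 0 < `|u - t| by rewrite normr_gt0 subr_eq0.
have ew : e + `|u - t| != 0 by rewrite gt_eqF ?addr_gt0.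
(* This step keeps [k * `|u - t|] below [e] and [k] below [1] at once. *)
pose k := e / (e + `|u - t|).
have k0 : 0 < k by rewrite divr_gt0 ?addr_gt0.
have k1 : k <= 1 by rewrite ler_pdivrMr ?addr_gt0 // mul1r lerDl ltW.
have /= H := eI (t + k * (u - t)).
apply: H.
- rewrite /ball_ /= opprD addNKr normrN normrM gtr0_norm // /k mulrAC.
  by rewrite ltr_pdivrMr ?addr_gt0 // ltr_pM2l // ltrDr.
- by rewrite -subr_eq0 [t + _]addrC addrK mulf_eq0 subr_eq0 negb_or ut gt_eqF.
- have [tu|tu] := leP t u.
    by apply: (interval_is_interval tI uI); apply/andP; split; nra.
  by apply: (interval_is_interval uI tI); apply/andP; split; nra.
Qed.

Implicit Types (I : interval R) (f g : R -> R[i]) (t : R) (a b : R[i]).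

Lemma is_tderive_tderivable I f t a : is_tderive I f t a -> tderivable I f t.
Proof. by move=> fa; apply/cvg_ex; exists a. Qed.

(** Write [f s] as [(s - t) * tquotient f t s + f t]: the first term tends to
    zero. *)
Lemma is_tderive_continuous I f t a : is_tderive I f t a ->
  f s @[s --> within [set` I] t^'] --> f t.
Proof.
rewrite /is_tderive => fa.
have st0 : (fun s : R => (s - t)%:C) @ within [set` I] t^' --> (0 : R[i]).
  apply/cvgr0Pnorm_lt => e e0.
  (* A positive element of [R[i]] is a positive real number. *)
  have [e1 e2] : 0 < complex.Re e /\ e = (complex.Re e)%:C.
    by case: e e0 => x y; rewrite ltcE /= => /andP[/eqP -> x0].
  have tball : \forall s \near within [set` I] t^', ball t (complex.Re e) s.
    apply: cvg_within; apply: nbhs_dnbhs; exact: nbhsx_ballx.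
  apply: filterS tball => s ts; rewrite e2.
  by rewrite normc_def /= expr0n addr0 sqrtr_sqr ltcR distrC.
pose proof (cvgD (cvgM st0 fa) (cvg_cst (f t))) as H.
rewrite mul0r add0r in H.
apply: (cvg_trans (near_eq_cvg _) H).
have neq_t : \forall s \near within [set` I] t^', s != t.
  by apply: cvg_within; exact: (nbhs_dnbhs_neq t).
apply: filterS neq_t => s st; rewrite /tquotient fctE /=.
by rewrite mulrA -rmorphM mulfV ?subr_eq0 // mul1r subrK.
Qed.

Lemma is_tderive_near I f g t a :
  (\forall s \near within [set` I] t^', f s = g s) -> f t = g t ->
  is_tderive I f t a -> is_tderive I g t a.
Proof.
rewrite /is_tderive => fg fgt H; apply: (cvg_trans (near_eq_cvg _) H).
by apply: filterS fg => s; rewrite /tquotient fgt => ->.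
Qed.

Lemma is_tderiveD I f g t a b : is_tderive I f t a -> is_tderive I g t b ->
  is_tderive I (fun s => f s + g s) t (a + b).
Proof.
rewrite /is_tderive => fa gb.
pose proof (cvgD fa gb) as H.
apply: (cvg_trans (near_eq_cvg _) H).
by apply: nearW => s; rewrite /tquotient /= !fctE; ring.
Qed.

Lemma is_tderive_cst I t c : is_tderive I (fun=> c) t 0.
Proof.
rewrite /is_tderive; apply: (cvg_trans (near_eq_cvg _) (cvg_cst 0)).
by apply: nearW => s; rewrite /tquotient subrr mulr0.
Qed.

Lemma is_tderiveMr I f t a c : is_tderive I f t a ->
  is_tderive I (fun s => f s * c) t (a * c).
Proof.
rewrite /is_tderive => fa.
pose proof (cvgMr_tmp (b := c) fa) as H.
apply: (cvg_trans (near_eq_cvg _) H).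
by apply: nearW => s; rewrite /tquotient /=; ring.
Qed.

Lemma is_tderive_div I f g t a b : g t != 0 ->
  is_tderive I f t a -> is_tderive I g t b ->
  is_tderive I (fun s => f s / g s) t ((a * g t - f t * b) / g t ^+ 2).
Proof.
move=> gt0 fa gb; have gc := is_tderive_continuous gb.
have gs0 : \forall s \near within [set` I] t^', g s != 0.
  exact: cvgr_neq0 gc gt0.
pose proof cvgV (mulf_neq0 gt0 gt0) (cvgMr_tmp (b := g t) gc) as ggV.
pose proof (cvgM
  (cvgD (cvgMr_tmp (b := g t) fa) (cvgMr_tmp (b := - f t) gb)) ggV) as H.
rewrite mulrN [b * _]mulrC -expr2 in H.
apply: (cvg_trans (near_eq_cvg _) H).
apply: filterS gs0 => s gs0; rewrite /tquotient /= !fctE.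
(* The factor [(s - t)^-1] is common to both sides; left in place, it would
   force [field] to ask for [s != t]. *)
by move: ((s - t)^-1)%:C => c; field; rewrite gt0 gs0.
Qed.

Lemma is_tderive_sum I (N : nat) (f : nat -> R -> R[i]) t (a : nat -> R[i]) :
  (forall k, (k < N)%N -> is_tderive I (f k) t (a k)) ->
  is_tderive I (fun s => \sum_(k < N) f k s) t (\sum_(k < N) a k).
Proof.
elim: N => [_|N ih fa].
  rewrite big_ord0; under eq_fun do rewrite big_ord0; exact: is_tderive_cst.
rewrite big_ord_recr; under eq_fun do rewrite big_ord_recr.
by apply: is_tderiveD; [apply: ih => k /ltnW|]; exact: fa.
Qed.

(** The uniform bound [N] on the sizes turns evaluation at [y] into one fixed
    finite linear combination of the coefficients. *)
Lemma is_tderive_horner I (N : nat) (p : R -> {poly R[i]})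
    (q : {poly R[i]}) t y :
  t \in I ->
  (forall s, s \in I -> (size (p s) <= N)%N) -> (size q <= N)%N ->
  (forall k, (k < N)%N -> is_tderive I (fun s => (p s)`_k) t q`_k) ->
  is_tderive I (fun s => (p s).[y]) t q.[y].
Proof.
move=> tI pN qN pq; rewrite (horner_coef_wide _ qN).
apply: (is_tderive_near (f := fun s => \sum_(k < N) (p s)`_k * y ^+ k)) => //.
- apply: filterS (withinT _ _) => s sI.
  by rewrite (horner_coef_wide _ (pN _ sI)).
- by rewrite (horner_coef_wide _ (pN _ tI)).
- apply: (is_tderive_sum (f := fun k s => (p s)`_k * y ^+ k)
    (a := fun k => q`_k * y ^+ k)) => k kN.
  exact: is_tderiveMr (pq _ kN).
Qed.

(** This is the commutation of the derivatives in time and in space. It is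
    purely algebraic: formal derivation is linear in the coefficients, so its
    coefficients are differentiated in time like those of [p]. *)
Lemma is_tderive_horner_deriv I (N : nat) (p : R -> {poly R[i]})
    (q : {poly R[i]}) t y :
  t \in I ->
  (forall s, s \in I -> (size (p s) <= N)%N) -> (size q <= N)%N ->
  (forall k, (k < N)%N -> is_tderive I (fun s => (p s)`_k) t q`_k) ->
  is_tderive I (fun s => (p s)^`().[y]) t q^`().[y].
Proof.
have size_deriv (u : {poly R[i]}) : (size u <= N)%N -> (size (deriv u) <= N.-1)%N.
  move=> uN; apply: leq_trans (size_poly _ _) _.
  by rewrite -!subn1 leq_sub2r.
move=> tI pN qN pq; apply: (@is_tderive_horner _ N.-1) => //.
- by move=> s sI; apply/size_deriv/pN.
- exact: size_deriv.
move=> k kN; rewrite coef_deriv -mulr_natr.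
apply: (is_tderive_near (f := fun s => (p s)`_k.+1 * k.+1%:R)) => //.
- by apply: nearW => s; rewrite coef_deriv mulr_natr.
- by rewrite coef_deriv mulr_natr.
- by apply: is_tderiveMr; apply: pq; rewrite -ltn_predRL.
Qed.

Lemma is_tderiveE I f t a :
  (exists u v, [/\ u \in I, v \in I & u < v]) -> t \in I ->
  is_tderive I f t a -> tderive I f t = a.
Proof.
move=> I_nondeg tI; have FF := within_dnbhs_proper I_nondeg tI.
exact: cvg_lim.
Qed.

End IntervalDerivatives.

(** * The equation for the Cauchy transform *)

(** The Cauchy transform of the empirical root distribution is the logarithmic
    derivative of the polynomial, up to the factor [1/d]. *)
Lemma cauchy_transformE (R : realType) (d : nat) (r : 'I_d -> R -> R)
    (t : R) (y : R[i]) :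
  let P := sq_root_poly r t in
  P.[y] != 0 ->
  cauchy_transform r y t = d%:R^-1 * (P^`().[y] / P.[y]).
Proof. by move=> P /logderiv_prod_XsubC ->. Qed.

Theorem proposition3p7 (R : realType) (n d : nat)
    (d_ge1 : (1 <= d)%N) (le_dn : (d <= n)%N)
    (I : interval R)
    (I_nondeg : exists a b : R, [/\ a \in I, b \in I & a < b])
    (r : 'I_d -> R -> R) (p : R -> {poly R[i]})
    (pE : forall t, t \in I -> p t = sq_root_poly r t)
    (p_coef : forall (k : nat) (t : R), t \in I ->
       tderivable I (fun s => (p s)`_k) t)
    (p_pde : forall (t : R) (x : R[i]), t \in I ->
       tderive I (peval p x) t =
       - 2 * (x * (peval p ^~ t)^`(2)%classic x
              + (n + 1)%:R * (peval p ^~ t)^`()%classic x)) :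
  let G := cauchy_transform r in
  let F t (y : R[i]) : R[i] :=
    d%:R * y * G y t ^+ 2 + (n + 1)%:R * G y t + y * (G ^~ t)^`()%classic y in
  forall (t : R) (x : R[i]), t \in I ->
    (forall i : 'I_d, x <> (r i t ^+ 2)%:C) ->
    [/\ tderivable I (G x) t,
        derivable (G ^~ t) x 1,
        derivable (F t) x 1
      & tderive I (G x) t + 2 * (F t)^`()%classic x = 0].
Proof.
move=> G F t x tI xr.
have GE s y : s \in I -> (p s).[y] != 0 ->
    G y s = d%:R^-1 * ((p s)^`().[y] / (p s).[y]).
  by move=> sI; rewrite pE //; exact: cauchy_transformE.
have d0 : d%:R != 0 :> R[i] by rewrite pnatr_eq0 -lt0n.
have Px : (p t).[x] != 0.
  by rewrite pE //; apply/prod_XsubC_neq0 => i; apply/eqP.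
(* [Q] is the time derivative of [p] at time [t]. *)
pose Q := \poly_(k < d.+1) tderive I (fun s => (p s)`_k) t.
have p_size s : s \in I -> (size (p s) <= d.+1)%N.
  move=> sI.
  by rewrite pE // /sq_root_poly -big_enum size_prod_XsubC size_enum_ord.
have Q_size : (size Q <= d.+1)%N := size_poly _ _.
have dcoef k : (k < d.+1)%N -> is_tderive I (fun s => (p s)`_k) t Q`_k.
  by move=> kd; rewrite coef_poly kd; exact: (p_coef k t tI).
have dP y : is_tderive I (fun s => (p s).[y]) t Q.[y].
  exact: is_tderive_horner p_size Q_size dcoef.
have dP' y : is_tderive I (fun s => (p s)^`().[y]) t Q^`().[y].
  exact: is_tderive_horner_deriv p_size Q_size dcoef.
have QE y : Q.[y] = - 2 * (y * (p t)^`()^`().[y] + (n + 1)%:R * (p t)^`().[y]).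
  rewrite -(is_tderiveE I_nondeg tI (dP y)) (p_pde t y tI).
  by rewrite [peval p ^~ t]/(horner (p t)) /derive1n /= !derive1_horner.
have near_p0 y : (p t).[y] != 0 -> \forall z \near y, (p t).[z] != 0.
  exact: near_horner_neq0.
have dG y : (p t).[y] != 0 -> is_derive y 1 (G ^~ t) (d%:R^-1 *
    ((((p t)^`()^`().[y]) * (p t).[y] - (p t)^`().[y] ^+ 2) / (p t).[y] ^+ 2)).
  move=> py; apply: (near_eq_is_derive
      (f := fun z => d%:R^-1 * ((p t)^`().[z] / (p t).[z]))).
    by apply: filterS (near_p0 _ py) => z pz; rewrite GE.
  apply: (is_derive_eq (is_deriveZ _ (is_derive_horner_frac _ py))).
  by rewrite expr2.
(* In [d y G^2 + y G'] the squares of [p'/p] cancel, which leaves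
   [F = (y p'' + (n + 1) p') / (d p)], and the equation for [p] identifies the
   numerator with [- Q / 2]. *)
have dF : is_derive x 1 (F t) (- (2 * d%:R)^-1 *
    ((Q^`().[x] * (p t).[x] - Q.[x] * (p t)^`().[x]) / (p t).[x] ^+ 2)).
  apply: (near_eq_is_derive
      (f := fun y => - (2 * d%:R)^-1 * (Q.[y] / (p t).[y]))).
    apply: filterS (near_p0 _ Px) => y py.
    rewrite /F GE // derive1E; case: (dG y py) => _ ->; rewrite QE.
    by field; rewrite py d0.
  exact: is_deriveZ (is_derive_horner_frac _ Px).
have dtG : is_tderive I (G x) t (d%:R^-1 *
    ((Q^`().[x] * (p t).[x] - (p t)^`().[x] * Q.[x]) / (p t).[x] ^+ 2)).
  (* The points [s] where [x] is a root of [p s] have to be avoided: there the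
     convention [0^-1 = 0] breaks the formula for the Cauchy transform. *)
  apply: (is_tderive_near
      (f := fun s => (p s)^`().[x] / (p s).[x] * d%:R^-1)).
  - have nx : \forall s \near within [set` I] t^', (p s).[x] != 0.
      exact: cvgr_neq0 (is_tderive_continuous (dP x)) Px.
    apply: filterS2 (withinT _ _) nx => s sI px.
    by rewrite GE // mulrC.
  - by rewrite GE // mulrC.
  - by rewrite mulrC; apply: is_tderiveMr; apply: is_tderive_div.
split.
- exact: is_tderive_tderivable dtG.
- by case: (dG x Px).
- by case: dF.
- rewrite (is_tderiveE I_nondeg tI dtG) derive1E; case: dF => _ ->.
  by field; rewrite d0 Px.
Qed.
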